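(* Let $\sigma,\theta$ be substitutions and $\alpha$ a prenaming safe for both $\sigma$ and $\theta$. Then $\alpha(\sigma\circ\theta)=\alpha(\sigma)\circ\alpha(\theta)$.
   Context: $V$ is a countably infinite set of variables. A substitution maps variables to terms with finite active domain $\mathrm{Dom}(\theta)=\{x:\theta(x)\neq x\}$, extended homomorphically to terms; $(\theta\circ\sigma)(x)=\theta(\sigma(x))$; $\mathrm{vars}(\theta)=\mathrm{Dom}(\theta)\cup\mathrm{vars}(\theta(\mathrm{Dom}(\theta)))$. A prenaming is a substitution $\alpha$ mapping variables to variables together with a fixed finite set $C^+(\alpha)\supseteq\mathrm{Dom}(\alpha)$ (relaxed core) on which $\alpha$ is injective; $R^+(\alpha)=\alpha(C^+(\alpha))$. $\mathrm{indom}(\alpha)=V\setminus(R^+(\alpha)\setminus C^+(\alpha))$; $\alpha$ is safe for a substitution $\sigma$ if $\mathrm{vars}(\sigma)\subseteq\mathrm{indom}(\alpha)$. The substitution variant is $\alpha(\sigma):=\{\alpha(x)/\alpha(\sigma(x)):x\in\mathrm{Dom}(\sigma)\}$, i.e. the substitution sending $\alpha(x)$ to $\alpha(\sigma(x))$ for $x\in\mathrm{Dom}(\sigma)$ and identity elsewhere. *)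

(* Defs.v *)
From HB Require Import structures.
From mathcomp Require Import all_boot finmap.

Set Implicit Arguments.
Unset Strict Implicit.
Unset Printing Implicit Defensive.

Local Open Scope fset_scope.

Definition countably_infinite (V : Type) : Prop :=
  exists f : V -> nat, bijective f.

Record signature := Signature { symbol : eqType; arity : symbol -> nat }.

Unset Elimination Schemes.
Inductive term (S : signature) (V : Type) :=
  | Var of V
  | App (f : symbol S) of {ffun 'I_(arity f) -> term S V}.
Set Elimination Schemes.

Arguments Var {S V} x.
Arguments App {S V} f a.

Lemma term_ind (S : signature) (V : Type) (P : term S V -> Prop) :
    (forall x, P (Var x)) ->
    (forall f (a : {ffun 'I_(arity f) -> term S V}),
       (forall i, P (a i)) -> P (App f a)) ->
  forall t, P t.
Proof.
move=> PV PA; fix IH 1 => -[x|f a]; first exact: PV.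
by apply: PA => i; apply: IH.
Qed.

Section TermEq.
Variables (S : signature) (V : eqType).

Fixpoint term_encode (t : term S V) : GenTree.tree (V + symbol S) :=
  match t with
  | Var x => GenTree.Leaf (inl x)
  | App f a => GenTree.Node 0
      (GenTree.Leaf (inr f) :: [seq term_encode (a i) | i <- enum 'I_(arity f)])
  end.

Lemma term_encode_inj : injective term_encode.
Proof.
elim=> [x|f a IH] [y|g b] //=; first by case=> ->.
case=> eq_fg; case: _ / eq_fg b => b /eq_in_map eq_ab.
congr App; apply/ffunP => i; apply: IH.
by apply: eq_ab; rewrite mem_enum.
Qed.

HB.instance Definition _ :=
  hasDecEq.Build (term S V) (inj_eqAxiom term_encode_inj).

End TermEq.

Section Substitutions.
Variables (S : signature) (V : choiceType).

Fixpoint vars (t : term S V) : {fset V} :=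
  match t with
  | Var x => [fset x]
  | App f a => \bigcup_(i <- enum 'I_(arity f)) vars (a i)
  end.

(* The domain {x | s x != Var x} of a substitution s is [finsupp s]. *)
Definition subst := {fsfun V -> term S V for @Var S V}.

Fixpoint apply (s : subst) (t : term S V) : term S V :=
  match t with
  | Var x => s x
  | App f a => App f [ffun i => apply s (a i)]
  end.

Definition subst_comp (theta sigma : subst) : subst :=
  [fsfun x in finsupp theta `|` finsupp sigma => apply theta (sigma x) | Var x].

Lemma subst_compE (theta sigma : subst) x :
  subst_comp theta sigma x = apply theta (sigma x).
Proof.
rewrite fsfunE in_fsetU; case: ifPn => //; rewrite negb_or => /andP[xt xs].
by rewrite (fsfun_dflt xs) /= (fsfun_dflt xt).
Qed.

Definition subst_vars (s : subst) : {fset V} :=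
  finsupp s `|` \bigcup_(x <- finsupp s) vars (s x).

Definition is_var (t : term S V) : bool := if t is Var _ then true else false.

(* [rcore] is the relaxed core C^+; it is part of the data of a prenaming. *)
Record prenaming := Prenaming {
  pren_subst :> subst;
  rcore : {fset V};
  _ : forall x, is_var (pren_subst x);
  _ : finsupp pren_subst `<=` rcore;
  _ : {in rcore &, injective pren_subst} }.

(* The default branch is never taken, see [pvarE]. *)
Definition pvar (alpha : prenaming) (x : V) : V :=
  if pren_subst alpha x is Var y then y else x.

Lemma pvarE (alpha : prenaming) x : pren_subst alpha x = Var (pvar alpha x).
Proof. by rewrite /pvar; case: alpha => a C /= /(_ x); case: (a x). Qed.

Definition rrange (alpha : prenaming) : {fset V} :=
  [fset pvar alpha x | x in rcore alpha].

Definition indom (alpha : prenaming) : {pred V} :=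
  [pred x | x \notin rrange alpha `\` rcore alpha].

Definition safe (alpha : prenaming) (s : subst) : Prop :=
  {subset subst_vars s <= indom alpha}.

(* {alpha x / alpha (s x) : x in Dom s}. If alpha identifies two elements of
   Dom s, the set of bindings need not be functional and [pick] selects one
   binding; this cannot happen when alpha is safe for s, see [variant_in]. *)
Definition variant (alpha : prenaming) (s : subst) : subst :=
  [fsfun y in [fset pvar alpha x | x in finsupp s] =>
     if [pick x : finsupp s | pvar alpha (val x) == y] is Some x
     then apply alpha (s (val x)) else Var y | Var y].

Lemma pvar_indom_inj (alpha : prenaming) : {in indom alpha &, injective (pvar alpha)}.
Proof.
case: alpha => a C va dC iC; set al := Prenaming va dC iC.
have out x : x \notin C -> pvar al x = x.
  move=> xC; have /fsfun_dflt : x \notin finsupp a.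
    by apply: contra xC; apply: (fsubsetP dC).
  by rewrite [a x](pvarE al) => -[].
have mixed x y : x \in C -> y \notin C -> y \in indom al -> pvar al x <> pvar al y.
  move=> xC yC; rewrite !inE /= yC /= => /negP yR e; apply: yR.
  by rewrite -(out y yC) -e; apply/imfsetP; exists x.
move=> x y xi yi e; have [xC|xC] := boolP (x \in C); have [yC|yC] := boolP (y \in C).
- by apply: (iC x y xC yC); rewrite [LHS](pvarE al) [RHS](pvarE al) e.
- by case: (mixed x y).
- by case: (mixed y x).
- by rewrite -(out x) // -(out y).
Qed.

Lemma variant_in (alpha : prenaming) (s : subst) x :
  safe alpha s -> x \in finsupp s ->
  variant alpha s (pvar alpha x) = apply alpha (s x).
Proof.
move=> sf xs; rewrite fsfunE in_imfset //=.
have ind z : z \in finsupp s -> z \in indom alpha.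
  by move=> zs; apply: sf; rewrite in_fsetU zs.
case: pickP => [z /eqP e|/(_ [` xs])]; last by rewrite eqxx.
by rewrite (pvar_indom_inj _ _ e) // ind // fsvalP.
Qed.

Lemma variant_out (alpha : prenaming) (s : subst) y :
  y \notin [fset pvar alpha x | x in finsupp s] -> variant alpha s y = Var y.
Proof. by move=> /negPf yN; rewrite fsfunE yN. Qed.

End Substitutions.

(* Main.v *)
(** On the injectivity domain of [alpha], the variant of [s] satisfies
    alpha(s) (alpha x) = alpha (s x) also outside Dom s, because injectivity
    keeps [alpha x] out of alpha(Dom s). This extends to terms over that domain,
    and the composition is safe since its variables are among those of [sigma]
    and [theta]. Hence both sides agree on alpha(Dom sigma `|` Dom theta), and
    elsewhere both are the identity. *)
Require Import Defs.
From mathcomp Require Import all_boot finmap.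

Set Implicit Arguments.
Unset Strict Implicit.
Unset Printing Implicit Defensive.

Local Open Scope fset_scope.

Section SubstitutionVariant.
Variables (S : signature) (V : choiceType).
Implicit Types (s theta sigma : subst S V) (t : term S V).
Implicit Types (alpha : prenaming S V) (A : {pred V}).

Lemma vars_App_sub A (f : symbol S) (a : {ffun 'I_(arity f) -> term S V}) :
  {subset vars (App f a) <= A} <-> forall i, {subset vars (a i) <= A}.
Proof.
split=> [aA i x xa|aA x /bigfcupP[i _ /aA//]].
by apply: aA; apply/bigfcupP; exists i; rewrite // mem_enum.
Qed.

(** Off [finsupp s] the only variable of [s x] is [x] itself, hence the assumption on [x]. *)
Lemma vars_subst_sub A s x :
  {subset subst_vars s <= A} -> x \in A -> {subset vars (s x) <= A}.
Proof.
move=> sA xA y; have [xs ys|xs] := boolP (x \in finsupp s).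
  by apply: sA; rewrite in_fsetU; apply/orP/or_intror/bigfcupP; exists x; rewrite ?xs.
by rewrite (fsfun_dflt xs) /= inE => /eqP->.
Qed.

Lemma vars_apply_sub A s t :
  {subset subst_vars s <= A} -> {subset vars t <= A} ->
  {subset vars (apply s t) <= A}.
Proof.
move=> sA; elim: t => [x|f a IH] tA.
  by apply: vars_subst_sub => //; apply: tA; rewrite /= inE.
move/vars_App_sub: tA => aA; apply/vars_App_sub => i.
by rewrite ffunE; apply: IH.
Qed.

(** The inclusion can be strict: [sigma] may undo a binding of [theta]. *)
Lemma finsupp_subst_comp sigma theta :
  finsupp (subst_comp sigma theta) `<=` finsupp sigma `|` finsupp theta.
Proof.
apply/fsubsetP => x; apply: contraLR; rewrite in_fsetU negb_or => /andP[xs xt].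
by rewrite memNfinsupp subst_compE (fsfun_dflt xt) /= (fsfun_dflt xs).
Qed.

(** Taking [A] to be [indom alpha] yields safety of [alpha] for the composition. *)
Lemma subst_vars_comp_sub A sigma theta :
  {subset subst_vars sigma <= A} -> {subset subst_vars theta <= A} ->
  {subset subst_vars (subst_comp sigma theta) <= A}.
Proof.
move=> sA tA.
have domA x : x \in finsupp (subst_comp sigma theta) -> x \in A.
  move/(fsubsetP (finsupp_subst_comp _ _)); rewrite in_fsetU => /orP[] xd.
    by apply: sA; rewrite in_fsetU xd.
  by apply: tA; rewrite in_fsetU xd.
move=> y; rewrite in_fsetU => /orP[/domA//|/bigfcupP[x /andP[/domA xA _]]].
rewrite subst_compE; apply: vars_apply_sub => //.
exact: vars_subst_sub.
Qed.

Lemma variant_pvar alpha s x :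
  safe alpha s -> x \in indom alpha ->
  variant alpha s (pvar alpha x) = apply alpha (s x).
Proof.
move=> sf xi; have [|xs] := boolP (x \in finsupp s); first exact: variant_in.
rewrite (fsfun_dflt xs) /= pvarE variant_out //.
(* A [z] in [finsupp s] with the same image as [x] lies in [indom alpha] by safety, so it equals
   [x]. *)
apply: contra xs => /imfsetP[z /= zs e].
by rewrite (pvar_indom_inj xi _ e) //; apply: sf; rewrite in_fsetU zs.
Qed.

(** Homomorphic extension of [variant_pvar]; used with [t := theta x] to push [variant alpha sigma]
    through [alpha]. *)
Lemma apply_variant alpha s t :
  safe alpha s -> {subset vars t <= indom alpha} ->
  apply (variant alpha s) (apply alpha t) = apply alpha (apply s t).
Proof.
move=> sf; elim: t => [x|f a IH] ti /=.
  by rewrite pvarE /= variant_pvar //; apply: ti; rewrite /= inE.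
move/vars_App_sub: ti => ai; congr App.
by apply/ffunP => i; rewrite !ffunE; apply: IH.
Qed.

End SubstitutionVariant.

Theorem mainTheorem6 (S : signature) (V : choiceType)
    (infV : countably_infinite V)
    (sigma theta : subst S V) (alpha : prenaming S V)
    (safe_sigma : safe alpha sigma) (safe_theta : safe alpha theta) :
  variant alpha (subst_comp sigma theta) =
  subst_comp (variant alpha sigma) (variant alpha theta).
Proof.
apply/fsfunP => y; rewrite subst_compE.
(* The domain of the composition would be too small for the case split: where bindings cancel,
   [variant alpha theta] still moves the image. *)
set D := finsupp sigma `|` finsupp theta.
have [/imfsetP[x /= xD ->]|yD] := boolP (y \in [fset pvar alpha x | x in D]).
  have xi : x \in indom alpha.
    move: xD; rewrite in_fsetU => /orP[] xd.
      by apply: safe_sigma; rewrite in_fsetU xd.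
    by apply: safe_theta; rewrite in_fsetU xd.
  have sf : safe alpha (subst_comp sigma theta) by apply: subst_vars_comp_sub.
  rewrite !variant_pvar // subst_compE apply_variant //.
  exact: vars_subst_sub.
(* Stated for any [s] with domain inside [D], to serve [sigma], [theta] and their composition
   alike. *)
have out (s : subst S V) : finsupp s `<=` D -> variant alpha s y = Var y.
  move=> /fsubsetP sD; apply: variant_out; apply: contra yD => /imfsetP[x /= xs ->].
  by rewrite in_imfset //=; apply: sD.
by rewrite (out _ (finsupp_subst_comp _ _)) (out theta) ?fsubsetUr //=
           (out sigma) ?fsubsetUl.
Qed.
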